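(* Let $\mathbf{A},\mathbf{B}$ be conducts with disjoint carriers. Then $\mathbf{A}\multimap\mathbf{B}=(\mathbf{A}\otimes\mathbf{B}^\perp)^\perp$.
   Context: Graphs. A directed weighted graph is a tuple $G=(V_G,E_G,s_G,t_G,\omega_G)$. Here $V_G$ is a finite vertex set, $E_G$ is a finite or countable edge set, $s_G,t_G$ are the source and target maps, and $\omega_G:E_G\to(0,1]$ gives the weights. Paths are finite sequences of consecutive edges, with weight the product of edge weights; cycles are paths ending where they start. A $1$-cycle is a cycle not of the form $\rho^k$ with $k\ge2$. A $1$-circuit is the class of a $1$-cycle under cyclic permutation. - $G\cup H$ has vertex set $V_G\cup V_H$ and edge set $E_G\sqcup E_H$. Its edges are coloured $\delta=0$ (from $G$) or $1$ (from $H$). - Alternating paths have consecutive edges of different colours. Alternating cycles additionally have first and last edges of different colours. $\mathrm{Cycl}(G,H)$ is the set of alternating $1$-circuits. - $G::H$ has vertex set $V_G\triangle V_H$; its edges are the alternating paths with endpoints in $V_G\triangle V_H$, carrying their source, target and weight. - $\langle G,H\rangle=\sum_{\pi\in\mathrm{Cycl}(G,H)}-\log(1-\omega(\pi))$, with $-\log 0=\infty$. Projects. - A project is $(a,A)$ with $a\in[0,\infty)$ and $A$ a graph; its carrier is $V_A$. - $\langle\!\langle\mathfrak{a},\mathfrak{b}\rangle\!\rangle=a+b+\langle A,B\rangle$. Projects of the same carrier are orthogonal if this is $\notin\{0,\infty\}$. - $S^\perp$ is the set of projects (of the common carrier of $S$) orthogonal to all of $S$. A conduct is a nonempty set $\mathbf{A}$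 of projects of a common carrier with $\mathbf{A}=\mathbf{A}^{\perp\perp}$. - For disjoint carriers, $(a,A)\otimes(b,B)=(a+b,A\cup B)$ and $\mathbf{A}\otimes\mathbf{B}=\{\mathfrak{a}\otimes\mathfrak{b}:\mathfrak{a}\in\mathbf{A},\mathfrak{b}\in\mathbf{B}\}^{\perp\perp}$. - If $\langle\!\langle\mathfrak{f},\mathfrak{g}\rangle\!\rangle\ne\infty$, then $\mathfrak{f}::\mathfrak{g}=(\langle\!\langle\mathfrak{f},\mathfrak{g}\rangle\!\rangle,F::G)$. - $\mathbf{A}\multimap\mathbf{B}$ is the set of projects $\mathfrak{f}$ such that for all $\mathfrak{a}\in\mathbf{A}$, $\mathfrak{f}::\mathfrak{a}$ is defined and lies in $\mathbf{B}$. *)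

(* Defs.v *)
From HB Require Import structures.
From mathcomp Require Import all_boot all_order all_algebra.
From mathcomp Require Import finmap.
From mathcomp Require Import all_classical all_reals all_analysis.

Set Implicit Arguments.
Unset Strict Implicit.
Unset Printing Implicit Defensive.

Import Order.TTheory GRing.Theory Num.Theory.

Local Open Scope classical_set_scope.
Local Open Scope ring_scope.

(* Interaction graphs. Vertices are drawn from an arbitrary ambient type U, so
   that carriers of different graphs can be united, compared and required to
   be disjoint. *)

Record graph (R : realType) (U : choiceType) := Graph {
  vertices : {fset U};
  edge : countType;
  src : edge -> U;
  tgt : edge -> U;
  weight : edge -> R;
  src_in : forall e, src e \in vertices;
  tgt_in : forall e, tgt e \in vertices;
  weight_itv : forall e, 0 < weight e <= 1
}.

Section Paths.
Variables (R : realType) (U : choiceType) (G : graph R U).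
Implicit Types p : seq (edge G).

Definition consecutive : rel (edge G) := [rel e f | tgt e == src f].

(* Paths and cycles are nonempty. In [cycle r p] the last item of p is also
   required to be r-related to the first one. *)
Definition is_path p := (p != [::]) && sorted consecutive p.
Definition is_cycle p := (p != [::]) && cycle consecutive p.

Definition seq_weight p : R := \prod_(e <- p) weight e.

Definition is_1cycle p : Prop :=
  is_cycle p /\
  ~ exists2 rho, is_cycle rho &
      exists2 k, (2 <= k)%N & p = flatten (nseq k rho).

Definition circuit_of p : set (seq (edge G)) := [set rot n p | n in [set: nat]].

(* The weight of a circuit is the weight of any of its representatives, see
   circuit_weightE. *)
Definition circuit_weight (c : set (seq (edge G))) : R :=
  seq_weight (xget [::] c).

Lemma circuit_weightE p : circuit_weight (circuit_of p) = seq_weight p.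
Proof.
rewrite /circuit_weight; case: xgetP => [_ -> [n _ <-]|/(_ p)].
  by apply: perm_big; rewrite perm_rot.
by case; exists 0%N => //; rewrite rot0.
Qed.

Lemma seq_weight_itv p : 0 < seq_weight p <= 1.
Proof.
rewrite /seq_weight; elim: p => [|e p /andP[p0 p1]].
  by rewrite big_nil ltr01 lexx.
have /andP[e0 e1] := weight_itv e.
by rewrite big_cons mulr_gt0//= mulr_ile1// ltW.
Qed.

End Paths.

Section Union.
Variables (R : realType) (U : choiceType) (G H : graph R U).

Definition union_src (e : edge G + edge H) : U :=
  match e with inl x => src x | inr y => src y end.
Definition union_tgt (e : edge G + edge H) : U :=
  match e with inl x => tgt x | inr y => tgt y end.
Definition union_weight (e : edge G + edge H) : R :=
  match e with inl x => weight x | inr y => weight y end.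

Fact union_src_in e : union_src e \in (vertices G `|` vertices H)%fset.
Proof. by case: e => e; rewrite in_fsetU src_in ?orbT. Qed.
Fact union_tgt_in e : union_tgt e \in (vertices G `|` vertices H)%fset.
Proof. by case: e => e; rewrite in_fsetU tgt_in ?orbT. Qed.
Fact union_weight_itv e : 0 < union_weight e <= 1.
Proof. by case: e => e; exact: weight_itv. Qed.

Definition graph_union : graph R U :=
  @Graph R U (vertices G `|` vertices H)%fset (edge G + edge H)%type
    union_src union_tgt union_weight
    union_src_in union_tgt_in union_weight_itv.

Definition colour (e : edge graph_union) : bool :=
  match e with inl _ => false | inr _ => true end.

Definition bicolour : rel (edge graph_union) :=
  [rel e f | colour e != colour f].

Definition is_alt_path (p : seq (edge graph_union)) :=
  is_path p && sorted bicolour p.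

(* The wrap-around condition of [cycle] says that the last and first edges
   have different colours. *)
Definition is_alt_cycle (p : seq (edge graph_union)) :=
  is_cycle p && cycle bicolour p.

Definition Cycl : set (set (seq (edge graph_union))) :=
  [set circuit_of p | p in [set p | is_1cycle p /\ is_alt_cycle p]].

(* [lne] is the extended logarithm, with lne 0 = -oo. *)
Definition bracket : \bar R :=
  (\esum_(c in Cycl) - lne (1 - circuit_weight c)%:E)%E.

Definition plug_vertices : {fset U} :=
  ((vertices G `\` vertices H) `|` (vertices H `\` vertices G))%fset.

(* The pair (e, q) stands for the nonempty path e :: q. *)
Definition plug_pred : pred (edge graph_union * seq (edge graph_union)) :=
  [pred p | [&& is_alt_path (p.1 :: p.2), src p.1 \in plug_vertices
              & tgt (last p.1 p.2) \in plug_vertices]].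

Definition plug_edge : countType := {p | plug_pred p}.

Definition plug_src (p : plug_edge) : U := src (val p).1.
Definition plug_tgt (p : plug_edge) : U := tgt (last (val p).1 (val p).2).
Definition plug_weight (p : plug_edge) : R :=
  seq_weight ((val p).1 :: (val p).2).

Fact plug_src_in p : plug_src p \in plug_vertices.
Proof. by have /and3P[] := valP p. Qed.
Fact plug_tgt_in p : plug_tgt p \in plug_vertices.
Proof. by have /and3P[] := valP p. Qed.
Fact plug_weight_itv p : 0 < plug_weight p <= 1.
Proof. exact: seq_weight_itv. Qed.

Definition graph_plug : graph R U :=
  @Graph R U plug_vertices plug_edge plug_src plug_tgt plug_weight
    plug_src_in plug_tgt_in plug_weight_itv.

Lemma bracket_ge0 : (0 <= bracket)%E.
Proof.
apply: esum_ge0 => _ [p _ <-]; rewrite circuit_weightE.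
have /andP[w0 w1] := seq_weight_itv p.
rewrite oppe_ge0; have [w|w] := leP (1 - seq_weight p) 0.
  by rewrite le0_lneNy// lee_fin.
by rewrite lne_EFin// lee_fin ln_le0// gerBl ltW.
Qed.

End Union.

Record project (R : realType) (U : choiceType) := Project {
  wager : R;
  pgraph : graph R U;
  wager_ge0 : 0 <= wager
}.

(* Plain predicates rather than [set (project R U)], which is ruled out by a
   universe constraint: a graph contains a countType. *)
Definition projects (R : realType) (U : choiceType) := project R U -> Prop.

Section Projects.
Variables (R : realType) (U : choiceType).
Implicit Types (a b f g : project R U) (V W : {fset U}).
Implicit Types A B S : projects R U.

Definition carrier a : {fset U} := vertices (pgraph a).

Definition measurement a b : \bar R :=
  ((wager a)%:E + (wager b)%:E + bracket (pgraph a) (pgraph b))%E.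

Lemma measurement_ge0 a b : (0 <= measurement a b)%E.
Proof.
by rewrite /measurement !adde_ge0 ?bracket_ge0// lee_fin wager_ge0.
Qed.

Definition orthogonal_proj a b : Prop :=
  [/\ carrier a = carrier b, measurement a b <> 0%E & measurement a b <> +oo%E].

(* The common carrier V of the elements of S is explicit, so that the dual is
   unambiguous even for empty S. *)
Definition dual V S : projects R U :=
  fun b => carrier b = V /\ forall a, S a -> orthogonal_proj a b.

Definition is_conduct V A : Prop :=
  [/\ exists a, A a, forall a, A a -> carrier a = V & A = dual V (dual V A)].

Definition proj_tensor a b : project R U :=
  Project (graph_union (pgraph a) (pgraph b))
    (addr_ge0 (wager_ge0 a) (wager_ge0 b)).

Definition tensor V W A B : projects R U :=
  let VW := (V `|` W)%fset in
  dual VW (dual VW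
    (fun c => exists a b, [/\ A a, B b & c = proj_tensor a b])).

Definition proj_plug f g (fg : measurement f g <> +oo%E) : project R U :=
  Project (graph_plug (pgraph f) (pgraph g)) (fine_ge0 (measurement_ge0 f g)).

Definition lolli A B : projects R U :=
  fun f => forall a, A a ->
    exists fa : measurement f a <> +oo%E, B (proj_plug fa).

End Projects.

(* Main.v *)
Require Import Defs.
From mathcomp Require Import all_boot all_order all_algebra.
From mathcomp Require Import finmap.
From mathcomp Require Import all_classical all_reals all_analysis.

(* Everything rests on the identity <F, A u B> = <F, A> + <F :: A, B> for
   disjoint A and B. An alternating 1-circuit of F and A u B that avoids B is an
   alternating 1-circuit of F and A. One that meets B is cut by its B-edges into
   alternating paths of F and A, which are edges of F :: A, and so becomes an
   alternating 1-circuit of F :: A and B. Primitivity survives because the words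
   spelled by the edges of F :: A and B form a code in which the B-edges mark
   the codeword boundaries. It follows that <<f :: a, b>> = <<f, a (x) b>>
   whenever f :: a is defined. For f in the right-hand side, f :: a is always
   defined because B^perp is never empty: it contains the project of wager 1
   without edges. *)

Set Implicit Arguments.
Unset Strict Implicit.
Unset Printing Implicit Defensive.

Import Order.TTheory GRing.Theory Num.Theory.

(** * Words up to rotation, powers and primitive words *)

Section Rotation.
Variable T : Type.
Implicit Types p q s : seq T.

Definition conjugate p q := exists n, p = rot n q.

Lemma conjugate_refl p : conjugate p p.
Proof. by exists 0; rewrite rot0. Qed.

Lemma conjugate_sym p q : conjugate p q -> conjugate q p.
Proof. by case=> n ->; exists (size (rot n q) - n); rewrite -[LHS](rotK n). Qed.

(** [rot n] is the identity once [n] reaches the size, so offsets do not simply add up; unit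
    rotations are composed one at a time instead. *)
Lemma conjugate_trans p q s : conjugate p q -> conjugate q s -> conjugate p s.
Proof.
case=> m -> [n ->]; elim: m => [|m [k IH]]; first by exists n; rewrite rot0.
have [lt_m|le_m] := ltnP m (size (rot n s)); last first.
  by exists n; rewrite rot_oversize ?leqW.
rewrite (rotS lt_m) IH; have [lt_k|le_k] := ltnP k (size s).
  by exists k.+1; rewrite (rotS lt_k).
by exists 1; rewrite (rot_oversize le_k).
Qed.

Lemma conjugate_cycle (r : rel T) p q : conjugate p q -> cycle r p = cycle r q.
Proof. by case=> n ->; rewrite rot_cycle. Qed.

(** The bound [k < 2] also rules out the empty word, which is its own square. *)
Definition primitive p := forall s k, p = flatten (nseq k s) -> k < 2.

Lemma primitive_neq0 p : primitive p -> p <> [::].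
Proof. by move=> + p0; rewrite p0 => /(_ [::] 2 erefl). Qed.

Lemma rot1_power s k :
  exists s', rot 1 (flatten (nseq k s)) = flatten (nseq k s').
Proof.
case: s => [|x s]; first by exists [::]; elim: k.
exists (rcons s x); case: k => [//|k] /=; rewrite rot1_cons.
elim: k => [|k IH] /=; first by rewrite !cats0.
by rewrite -cat1s rcons_cat cat1s rcons_cons IH /= -cat_rcons.
Qed.

Lemma conjugate_power p s k :
  conjugate p (flatten (nseq k s)) -> exists s', p = flatten (nseq k s').
Proof.
case=> n ->; elim: n => [|n [s' IH]]; first by exists s; rewrite rot0.
have [lt_n|le_n] := ltnP n (size (flatten (nseq k s))).
  by rewrite (rotS lt_n) IH; exact: rot1_power.
by exists s; rewrite rot_oversize // leqW.
Qed.

Lemma conjugate_primitive p q : conjugate p q -> primitive p -> primitive q.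
Proof.
move=> pq prim_p s k qE; rewrite qE in pq.
by have [s' /prim_p] := conjugate_power pq.
Qed.

(** The step from one copy of [s] to the next, or back to the start if [k] is 0, is the step that
    closes [s]. *)
Lemma cycle_power (r : rel T) s k :
  cycle r (flatten (nseq k.+1 s)) -> cycle r s.
Proof.
case: s => [//|x s] /=; rewrite rcons_cat cat_path => /andP[rs rx].
rewrite rcons_path rs.
by case: k rx => [|k] /= /andP[->].
Qed.

End Rotation.

(** * Codes whose special letters mark codeword boundaries, and their unique decoding *)

Section Code.
Variables (X Y : Type) (c : X -> seq Y) (r1 : rel X) (r2 : rel Y).
Variable special : pred Y.

Let special_word x := has special (c x).

Hypothesis c_neq0 : forall x, c x <> [::].
Hypothesis c_special : forall x, special_word x -> exists y, c x = [:: y].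
Hypothesis c_inj : injective c.
(** Two adjacent codewords without special letters would have no visible boundary between them; such
    pairs are excluded. *)
Hypothesis r1_special : forall x y, r1 x y -> special_word x || special_word y.
Hypothesis c_sorted : forall x, sorted r2 (c x).
Hypothesis c_rel : forall x y s t e f,
  c x = rcons s e -> c y = f :: t -> r2 e f = r1 x y.

Definition encode (p : seq X) : seq Y := flatten (map c p).

Lemma encode_cat p q : encode (p ++ q) = encode p ++ encode q.
Proof. by rewrite /encode map_cat flatten_cat. Qed.

Lemma encode_eq0 p : encode p = [::] -> p = [::].
Proof. by case: p => // x p; rewrite /encode /=; case: (c x) (@c_neq0 x). Qed.

Lemma encode_power p k :
  encode (flatten (nseq k p)) = flatten (nseq k (encode p)).
Proof. by elim: k => //= k IH; rewrite encode_cat IH. Qed.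

Lemma encode_conjugate p q : conjugate p q -> conjugate (encode p) (encode q).
Proof.
case=> n ->; exists (size (encode (take n q))).
by rewrite -{3}(cat_take_drop n q) encode_cat rot_size_cat -encode_cat.
Qed.

Lemma cat_special (s u v w : seq Y) y :
  ~~ has special s -> special y -> s ++ w = u ++ y :: v ->
  exists2 u', u = s ++ u' & w = u' ++ y :: v.
Proof.
elim: s u => [|z s IH] u /=; first by exists u.
rewrite negb_or => /andP[nz ns] sy; case: u => [|z' u] [zy E].
  by rewrite zy sy in nz.
by have [u' -> ->] := IH _ ns sy E; exists u'; rewrite ?zy.
Qed.

(* A special letter is a codeword by itself, so it marks codeword boundaries. *)
Lemma encode_align q u y v : special y -> encode q = u ++ y :: v ->
  exists q1 x q2,
    [/\ q = q1 ++ x :: q2, encode q1 = u, c x = [:: y] & encode q2 = v].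
Proof.
move=> sy; elim: q u => [|x q IH] u; first by case: u.
rewrite /encode /= -/(encode q).
have [/c_special[y' cx]|nx] := boolP (special_word x).
  rewrite cx; case: u => [|z u] [<- E]; first by exists [::], x, q.
  have [q1 [x' [q2 [-> E1 cx' E2]]]] := IH _ E.
  by exists (x :: q1), x', q2; split=> //; rewrite /encode /= cx -E1.
move=> /(cat_special nx sy)[u' -> /IH[q1 [x' [q2 [-> E1 cx' E2]]]]].
by exists (x :: q1), x', q2; split=> //; rewrite /encode /= -E1.
Qed.

(** The empty word counts, because the end of a word is a codeword boundary too. *)
Definition special_head (s : seq Y) := if s is y :: _ then special y else true.

(** Both factorizations cut right before the first special letter, or at the end if there is
    none. *)
Lemma special_head_cat_inj (u u' v v' : seq Y) :
  ~~ has special u -> ~~ has special u' -> special_head v -> special_head v' ->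
  u ++ v = u' ++ v' -> u = u' /\ v = v'.
Proof.
elim: u u' => [|y u IH] [|y' u'] //=.
- by move=> _ /norP[ny' _] + _ E; rewrite E /= (negbTE ny').
- by move=> /norP[ny _] _ _ + E; rewrite -E /= (negbTE ny).
- by move=> /norP[_ nu] /norP[_ nu'] hv hv' [-> /(IH _ nu nu' hv hv')[-> ->]].
Qed.

Lemma special_head_encode x p :
  path r1 x p -> ~~ special_word x -> special_head (encode p).
Proof.
case: p => //= y p /andP[/r1_special/orP[->//|sy] _] _.
have [z cy] := c_special sy.
by move: sy; rewrite /special_word /encode /= cy /= orbF.
Qed.

(** The first letter tells whether the first codeword is special. A special codeword is one letter
    long; any other one extends to the next special letter or to the end. *)
Lemma encode_inj p q :
  sorted r1 p -> sorted r1 q -> encode p = encode q -> p = q.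
Proof.
elim: p q => [|x p IH] q; first by move=> _ _ /esym/encode_eq0.
case: q => [_ _ /encode_eq0 //|x' q] xp x'q.
have sp := path_sorted xp; have sq := path_sorted x'q.
rewrite /encode /= -!/(encode _).
have [s|n] := boolP (special_word x); have [s'|n'] := boolP (special_word x').
- have [[y cx] [y' cx']] := (c_special s, c_special s').
  rewrite cx cx' => -[yy' /(IH _ sp sq)->].
  by congr (_ :: _); apply: c_inj; rewrite cx cx' yy'.
- have [y cx] := c_special s; move: s n'; rewrite /special_word cx /=.
  case: (c x') (@c_neq0 x') => //= z t _; rewrite orbF => + /norP[+ _] [yz _].
  by rewrite yz => ->.
- have [y cx] := c_special s'; move: s' n; rewrite /special_word cx /=.
  case: (c x) (@c_neq0 x) => //= z t _; rewrite orbF => + /norP[+ _] [yz _].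
  by rewrite yz => ->.
- have hp := special_head_encode xp n; have hq := special_head_encode x'q n'.
  by move=> /(special_head_cat_inj n n' hp hq)[/c_inj-> /(IH _ sp sq)->].
Qed.

Lemma sorted_encode p : sorted r2 (encode p) = sorted r1 p.
Proof.
elim: p => // x [|y p] IH; first by rewrite /encode /= cats0 c_sorted.
rewrite -cat1s encode_cat {1}/encode /= cats0.
move: IH (@c_sorted x) (@c_rel x y).
case/lastP: (c x) (@c_neq0 x) => // s e _.
rewrite /encode /= -/(encode p); case: (c y) (@c_neq0 y) => //= f t _ IH se.
move=> /(_ s t e f erefl erefl) <-.
by rewrite cat_rcons sorted_cat_cons se /= IH.
Qed.

Lemma cycle_encode p : cycle r2 (encode p) = cycle r1 p.
Proof.
case: p => // x p.
(* A cycle is a path with its first letter repeated at the end. Here the whole codeword of [x] is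
   repeated; its letters after the first add no condition, by [c_sorted]. *)
have := sorted_encode ((x :: p) ++ [:: x]); move: (@c_sorted x).
rewrite encode_cat /encode /= -/(encode p) cats0 cats1.
case: (c x) (@c_neq0 x) => //= f t _ ft <-.
by rewrite -cat_rcons cat_path last_rcons ft andbT.
Qed.

(** In a cycle the letter after a non-special one is special, so one rotation is enough. *)
Lemma conjugate_special_head p :
  cycle r1 p -> exists2 q, conjugate q p & special_head (encode q).
Proof.
case: p => [|x p] cp; first by exists [::] => //; exact: conjugate_refl.
have [sx|nx] := boolP (special_word x).
  have [y cx] := c_special sx; exists (x :: p); first exact: conjugate_refl.
  by move: sx; rewrite /special_word /encode /= cx /= orbF.
exists (rcons p x); first by exists 1; rewrite rot1_cons.
exact: special_head_encode cp nx.
Qed.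

(** Once [p] is rotated so that its encoding begins with a special letter, the offset in [encode q]
    points at a special letter, hence at a codeword boundary, and so it comes from a rotation of
    [q]. *)
Lemma encode_conjugate_inj p q : cycle r1 p -> cycle r1 q ->
  conjugate (encode p) (encode q) -> conjugate p q.
Proof.
move=> cp cq pq; have [p' pp' hp'] := conjugate_special_head cp.
have cp' : cycle r1 p' by rewrite (conjugate_cycle _ pp').
apply: conjugate_trans (conjugate_sym pp') _.
have cycle_sorted u : cycle r1 u -> sorted r1 u.
  by case: u => //= x u; rewrite rcons_path => /andP[].
have [n En] := conjugate_trans (encode_conjugate pp') pq.
have [le_n|lt_n] := leqP (size (encode q)) n.
  exists 0; rewrite rot0; apply: encode_inj; rewrite ?cycle_sorted //.
  by rewrite En rot_oversize.
move: En hp'; rewrite /rot; case E: (drop n (encode q)) => [|y v].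
  move: (congr1 size E); rewrite size_drop => /eqP.
  by rewrite subn_eq0 leqNgt lt_n.
move=> En; rewrite En /= => sy.
have qE : encode q = take n (encode q) ++ y :: v by rewrite -E cat_take_drop.
have [q1 [x [q2 [q12 E1 cx E2]]]] := encode_align sy qE.
have q21 : conjugate (x :: q2 ++ q1) q.
  by exists (size q1); rewrite q12 rot_size_cat.
suff -> : p' = x :: q2 ++ q1 by [].
apply: encode_inj; rewrite ?cycle_sorted ?(conjugate_cycle _ q21) //.
by rewrite En -cat_cons encode_cat E1 /encode /= cx -/(encode q2) E2.
Qed.

Lemma encode_power_inj p s k : sorted r1 p -> special_head s ->
  encode p = flatten (nseq k.+1 s) ->
  exists2 t, encode t = s & p = flatten (nseq k.+1 t).
Proof.
move=> + hs; elim: k p => [|k IH] p sp.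
  by rewrite /= cats0; exists p; rewrite //= cats0.
rewrite [RHS]/=; case: s hs IH => [_ _|y s sy IH E].
  have -> : flatten (nseq k [::]) = [::] :> seq Y by elim: (k).
  by move=> /encode_eq0 ->; exists [::] => //=; elim: (k).
(* The cut is made at the head [y] of the second copy. *)
have [p1 [x [p2 [pE E1 cx E2]]]] := encode_align (u := y :: s) sy E.
have [s1 s2] : sorted r1 p1 /\ sorted r1 (x :: p2).
  by move: sp; rewrite pE => /cat_sorted2[-> ->].
have [|t tE p2E] := IH _ s2; first by rewrite /encode /= cx -/(encode p2) E2.
suff p1t : p1 = t by exists t; rewrite // pE p2E p1t.
apply: encode_inj => //; last by rewrite E1.
by move: s2; rewrite p2E /= => /cat_sorted2[].
Qed.

(** A power is pulled back after rotating [p] to a codeword boundary: the root then satisfies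
    [special_head], as [encode_power_inj] requires. *)
Lemma primitive_encode p : cycle r1 p -> primitive (encode p) <-> primitive p.
Proof.
move=> cp; split=> prim_p; last first.
  move=> s k pE; rewrite ltnNge; apply/negP => k2.
  have [p' pp' hp'] := conjugate_special_head cp.
  have [s' E] : exists s', encode p' = flatten (nseq k s').
    by apply: (@conjugate_power _ _ s); rewrite -pE; exact: encode_conjugate.
  have sp' : sorted r1 p'.
    move: cp; rewrite -(conjugate_cycle _ pp').
    by case: (p') => //= x u; rewrite rcons_path => /andP[].
  have hs' : special_head s'.
    by move: hp'; rewrite E; case: (k) k2 => // j _; case: (s').
  case: k k2 E {pE} => // k k2 /(encode_power_inj sp' hs')[t _ p'E].
  have := conjugate_primitive (conjugate_sym pp') prim_p p'E.
  by rewrite ltnNge k2.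
by move=> s k pE; apply: (prim_p (encode s)); rewrite pE encode_power.
Qed.
End Code.

(** * Alternating 1-circuits and sums over them *)

Section Circuits.
Context {R : realType} {U : choiceType}.
Implicit Types G H K : graph R U.
Local Open Scope classical_set_scope.
Local Open Scope ring_scope.

Lemma circuit_of_eqP G (p q : seq (edge G)) :
  circuit_of p = circuit_of q <-> conjugate p q.
Proof.
split=> [pq|pq].
  have : circuit_of q p by rewrite -pq; exists 0%N => //; rewrite rot0.
  by case=> n _ <-; exists n.
apply/seteqP; split=> _ [n _ <-].
  have [|m ->] := @conjugate_trans _ (rot n p) p q _ pq; first by exists n.
  by exists m.
have [|m ->] := @conjugate_trans _ (rot n q) q p _ (conjugate_sym pq).
  by exists n.
by exists m.
Qed.

Lemma xget_circuit_of G (p : seq (edge G)) :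
  conjugate (xget [::] (circuit_of p)) p.
Proof.
case: xgetP => [_ -> [n _ <-]|/(_ p)]; first by exists n.
by case; exists 0%N => //; rewrite rot0.
Qed.

(** [is_1cycle] forbids only powers of cycles, [primitive] all powers; for a cycle this is the same
    by [cycle_power]. *)
Lemma is_1cycleP G (p : seq (edge G)) :
  is_1cycle p <-> is_cycle p /\ primitive p.
Proof.
split=> -[cp pp]; split=> //.
  move=> s k pE; rewrite ltnNge; apply/negP => k2; apply: pp; exists s.
    move: cp; rewrite /is_cycle pE => /andP[]; case: k k2 {pE} => // k _.
    case: s => [|x s _]; first by elim: k.
    by move=> /cycle_power ->.
  by exists k.
by case=> s _ [k k2 /pp]; rewrite ltnNge k2.
Qed.

(** Merging both conditions makes an alternating cycle a [cycle] of a single relation, to which the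
    code lemmas apply. *)
Definition alternating G H : rel (edge (graph_union G H)) :=
  [rel e f | consecutive e f && bicolour e f].

Lemma CyclE G H : @Cycl R U G H =
  [set circuit_of p | p in [set p | cycle (@alternating G H) p /\ primitive p]].
Proof.
apply/seteqP; split=> _ [p pp <-]; exists p => //.
  case: pp => /is_1cycleP[_ pp] /andP[/andP[_ cp] bp].
  by split=> //; rewrite cycle_relI cp.
case: pp; rewrite /= cycle_relI => /andP[cp bp] pp.
have p0 : p != [::] by apply/eqP/primitive_neq0.
by split; [apply/is_1cycleP|]; rewrite /is_alt_cycle /is_cycle p0 cp.
Qed.

Section EncodeCircuits.
Variables (G H : graph R U) (c : edge G -> seq (edge H)).
Variables (r1 : rel (edge G)) (r2 : rel (edge H)) (special : pred (edge H)).
(** Among the cycles of [r2], [Q] delimits the image of the encoding up to rotation. *)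
Variable Q : pred (seq (edge H)).
Hypothesis c_neq0 : forall x, c x <> [::].
Hypothesis c_special :
  forall x, has special (c x) -> exists y, c x = [:: y].
Hypothesis c_inj : injective c.
Hypothesis r1_special :
  forall x y, r1 x y -> has special (c x) || has special (c y).
Hypothesis c_sorted : forall x, sorted r2 (c x).
Hypothesis c_rel : forall x y s t e f,
  c x = rcons s e -> c y = f :: t -> r2 e f = r1 x y.
Hypothesis c_weight : forall x, seq_weight (c x) = weight x.
Hypothesis Q_encode : forall p, cycle r1 p -> p <> [::] -> Q (encode c p).
Hypothesis encode_surj : forall w, cycle r2 w -> w <> [::] -> Q w ->
  exists p, conjugate (encode c p) w.

Lemma seq_weight_encode p : seq_weight (encode c p) = seq_weight p.
Proof.
rewrite /seq_weight /encode big_flatten big_map.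
by apply: eq_bigr => x _; exact: c_weight.
Qed.

Lemma esum_encode (F : R -> \bar R) :
  (\esum_(C in [set circuit_of w | w in
       [set w | [/\ cycle r2 w, primitive w & Q w]]]) F (circuit_weight C) =
   \esum_(C in [set circuit_of p | p in [set p | cycle r1 p /\ primitive p]])
     F (circuit_weight C))%E.
Proof.
(* The chosen representative does not matter: conjugate words have conjugate encodings. *)
pose e (C : set (seq (edge G))) := circuit_of (encode c (xget [::] C)).
have eE p : e (circuit_of p) = circuit_of (encode c p).
  by apply/circuit_of_eqP/encode_conjugate/xget_circuit_of.
have cycleE := cycle_encode c_neq0 c_sorted c_rel.
have primE := primitive_encode c_neq0 c_special c_inj r1_special.
rewrite (@reindex_esum _ _ _
  [set circuit_of p | p in [set p | cycle r1 p /\ primitive p]] _ e).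
  apply: eq_esum => _ [p _ <-].
  by rewrite eE !circuit_weightE seq_weight_encode.
split=> [_ [p [cp pp] <-]|_ _ /set_mem[p [cp pp] <-] /set_mem[q [cq pq] <-]|].
- rewrite eE; exists (encode c p) => //; split; first by rewrite cycleE.
    exact/primE.
  by apply: Q_encode => //; exact: primitive_neq0.
- rewrite !eE => /circuit_of_eqP E; apply/circuit_of_eqP.
  exact: (encode_conjugate_inj c_neq0 c_special c_inj r1_special) E.
- move=> _ [w [cw pw Qw] <-].
  have [p pw'] := encode_surj cw (primitive_neq0 pw) Qw.
  have cp : cycle r1 p by rewrite -cycleE (conjugate_cycle _ pw').
  exists (circuit_of p); last by rewrite eE; exact/circuit_of_eqP.
  exists p => //; split=> //; apply/primE => //.
  exact: conjugate_primitive (conjugate_sym pw') pw.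
Qed.

End EncodeCircuits.

(** A relabelling is a code with one-letter codewords in which every letter is special. *)
Lemma esum_relabel G H (h : edge G -> edge H) (r1 : rel (edge G))
    (r2 : rel (edge H)) (Q : pred (seq (edge H))) (F : R -> \bar R) :
  injective h -> (forall x y, r2 (h x) (h y) = r1 x y) ->
  (forall x, weight (h x) = weight x) ->
  (forall p, Q (map h p)) -> (forall w, Q w -> exists p, w = map h p) ->
  (\esum_(C in [set circuit_of w | w in
       [set w | [/\ cycle r2 w, primitive w & Q w]]]) F (circuit_weight C) =
   \esum_(C in [set circuit_of p | p in [set p | cycle r1 p /\ primitive p]])
     F (circuit_weight C))%E.
Proof.
move=> h_inj h_rel h_weight Qh h_surj.
have encodeE p : encode (fun x => [:: h x]) p = map h p.
  by rewrite /encode flatten_map1.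
apply: (@esum_encode _ _ (fun x => [:: h x]) r1 r2 predT) => //.
- by move=> x _; exists (h x).
- by move=> x y [/h_inj].
- by move=> x y [|? []] // ? e f [<-] [<- _].
- by move=> x; rewrite /seq_weight big_seq1.
- by move=> p _ _; rewrite encodeE.
- move=> w _ _ /h_surj[p ->]; exists p; rewrite encodeE.
  exact: conjugate_refl.
Qed.

(** Any set [C] is allowed: if it is empty, [xget] returns the empty word, of weight 1. *)
Lemma circuit_log_ge0 G (C : set (seq (edge G))) :
  (0 <= - lne (1 - circuit_weight C)%:E)%E.
Proof.
have /andP[w0 w1] : 0 < circuit_weight C <= 1 := seq_weight_itv _.
rewrite oppe_ge0; have [w|w] := leP (1 - circuit_weight C) 0.
  by rewrite le0_lneNy// lee_fin.
by rewrite lne_EFin// lee_fin ln_le0// gerBl ltW.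
Qed.

Lemma bracketC G H : bracket G H = bracket H G.
Proof.
pose h (e : edge (graph_union H G)) : edge (graph_union G H) :=
  match e with inl x => inr x | inr x => inl x end.
pose h' (e : edge (graph_union G H)) : edge (graph_union H G) :=
  match e with inl x => inr x | inr x => inl x end.
rewrite /bracket !CyclE.
rewrite -(@esum_relabel _ _ h _ (@alternating G H) predT
  (fun w => - lne (1 - w)%:E)%E) //.
- congr (\esum_(C in _) _)%E; apply/seteqP.
  by split=> C [w + <-] => [[cw pw]|[cw pw _]]; exists w.
- by case=> x [] y //= [->].
- by case=> x [] y.
- by case.
- move=> w _; exists (map h' w); rewrite -map_comp.
  by rewrite (@eq_map _ _ _ id) ?map_id //; case.
Qed.

End Circuits.

(** * The bracket with a union, computed by plugging *)

Section PlugUnion.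
Context {R : realType} {U : choiceType} (F A B : graph R U).
Hypothesis subA : (vertices A `<=` vertices F)%fset.
Hypothesis subB : (vertices B `<=` vertices F)%fset.
Hypothesis disjAB : [disjoint vertices A & vertices B]%fset.
Local Open Scope classical_set_scope.
Local Open Scope ring_scope.

Let FAB := graph_union F (graph_union A B).
Let alt : rel (edge FAB) := @alternating _ _ F (graph_union A B).

Definition edgeB (e : edge FAB) : bool :=
  if e is inr (inr _) then true else false.

Definition embedA (e : edge (graph_union F A)) : edge FAB :=
  match e with inl f => inl f | inr a => inr (inl a) end.

Definition codeword (e : edge (graph_union (graph_plug F A) B)) :
    seq (edge FAB) :=
  match e with
  | inl p => map embedA ((val p).1 :: (val p).2)
  | inr b => [:: inr (inr b)]
  end.

Lemma embedA_inj : injective embedA.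
Proof. by case=> x [] y //= [->]. Qed.

Lemma embedA_alt x y : alt (embedA x) (embedA y) = alternating x y.
Proof. by case: x y => x [] y. Qed.

Lemma has_edgeB_embedA s : has edgeB (map embedA s) = false.
Proof. by elim: s => // -[]. Qed.

Lemma embedA_surj w : ~~ has edgeB w -> exists s, w = map embedA s.
Proof.
elim: w => [|e w IH]; first by exists [::].
rewrite /= negb_or => /andP[eB /IH[s ->]].
by case: e eB => [f|[a|//]] _; [exists (inl f :: s)|exists (inr a :: s)].
Qed.

Lemma in_plug_vertices v :
  v \in plug_vertices F A = (v \in vertices F) && (v \notin vertices A).
Proof.
rewrite /plug_vertices !inE; have [vA|vA] := boolP (v \in vertices A).
  by rewrite (fsubsetP subA) //= andbF.
by rewrite /= andbF orbF andbT.
Qed.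

Lemma vertices_plug v : v \in vertices B -> v \in plug_vertices F A.
Proof.
move=> vB; rewrite in_plug_vertices (fsubsetP subB) //=.
by apply/negP => /(fdisjointP disjAB); rewrite vB.
Qed.

(** As the vertices of [A] lie in [F], the endpoints of an edge of [F :: A] lie outside [A]; so its
    path begins and, by [plug_last], ends with an edge of [F]. *)
Lemma plug_head (p : plug_edge F A) : exists f, (val p).1 = inl f.
Proof.
have /and3P[_ + _] := valP p; rewrite in_plug_vertices.
by case: (val p).1 => [f|a]; [exists f|rewrite /= src_in andbF].
Qed.

Lemma plug_last (p : plug_edge F A) :
  exists f, last (val p).1 (val p).2 = inl f.
Proof.
have /and3P[_ _] := valP p; rewrite in_plug_vertices.
by case: (last _ _) => [f|a]; [exists f|rewrite /= tgt_in andbF].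
Qed.

Lemma plug_alt (p : plug_edge F A) :
  sorted (@alternating _ _ F A) ((val p).1 :: (val p).2).
Proof.
by have /and3P[/andP[/andP[_ cp] bp] _ _] := valP p; rewrite sorted_relI cp.
Qed.

Lemma codeword_neq0 x : codeword x <> [::].
Proof. by case: x. Qed.

Lemma codeword_edgeB x : has edgeB (codeword x) = colour x.
Proof. by case: x => // p; rewrite has_edgeB_embedA. Qed.

Lemma codeword_special x :
  has edgeB (codeword x) -> exists y, codeword x = [:: y].
Proof. by rewrite codeword_edgeB; case: x => // b _; exists (inr (inr b)). Qed.

Lemma codeword_inj : injective codeword.
Proof.
move=> x y E; have := codeword_edgeB x; rewrite E codeword_edgeB.
case: x y E => [p|b] [q|b'] //=; last by case=> ->.
move=> [/embedA_inj E1 /(inj_map embedA_inj) E2] _; congr inl; apply: val_inj.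
by rewrite [LHS]surjective_pairing [RHS]surjective_pairing E1 E2.
Qed.

Lemma codeword_sorted x : sorted alt (codeword x).
Proof.
case: x => // p; rewrite sorted_map.
by rewrite (@eq_sorted _ _ _ embedA_alt) plug_alt.
Qed.

(** Plugged paths begin and end in the colour of [F], and [B]-edges have the other colour. Hence
    colours change at a junction of codewords exactly when they do in the graph of [F :: A] and
    [B]. *)
Lemma codeword_rel x y s t e f : codeword x = rcons s e ->
  codeword y = f :: t -> alt e f = alternating x y.
Proof.
move=> /(congr1 (last e)); rewrite last_rcons => eE /(congr1 (head f)) /= fE.
have {}eE : e = last e (codeword x) by [].
case: x eE => [p|b]; case: y fE => [q|b'] <- ->.
- rewrite /= last_map; have [f1 ->] := plug_last p; have [f2 ->] := plug_head q.
  by rewrite /alt /alternating /= !andbF.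
- rewrite /= last_map /alternating /alt /= /consecutive /=.
  by have [f1 E] := plug_last p; rewrite /plug_tgt E.
- rewrite /= /alternating /alt /= /consecutive /=.
  by have [f1 E] := plug_head q; rewrite /plug_src E.
- rewrite /alt /alternating /= /bicolour /=. by rewrite ?eqxx ?andbF.
Qed.

Lemma codeword_weight x : seq_weight (codeword x) = weight x.
Proof.
case: x => [p|b]; last by rewrite /seq_weight big_seq1.
by rewrite /seq_weight big_map; apply: eq_bigr => -[].
Qed.

Lemma alternating_codeword x y :
  alternating x y -> has edgeB (codeword x) || has edgeB (codeword y).
Proof. by rewrite !codeword_edgeB => /andP[_]; case: x y => ? []. Qed.

Lemma encode_has_edgeB p : cycle (@alternating _ _ (graph_plug F A) B) p ->
  p <> [::] -> has edgeB (encode codeword p).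
Proof.
case: p => // x p cp _; rewrite /encode /= has_cat.
case: p cp => [|y p] /= /andP[/alternating_codeword].
  by rewrite orbb => ->.
by rewrite has_cat orbA => ->.
Qed.

(* Cutting a word at its B-edges leaves alternating paths of F and A joining
   vertices of B, that is, edges of F :: A. *)
Lemma decode_suffix w b : sorted alt (rcons w (inr (inr b))) ->
  exists s p, w = map embedA s ++ encode codeword p /\
    special_head edgeB (encode codeword p).
Proof.
elim: w => [|e w IH]; first by exists [::], [::].
(* [s] is the path still open on the left, [p] the decoded rest. *)
rewrite rcons_cons => ew; have [s [p [wE hp]]] := IH (path_sorted ew).
have cons_embedA x : e = embedA x ->
    exists s p, e :: w = map embedA s ++ encode codeword p /\
      special_head edgeB (encode codeword p).
  by move=> ->; exists (x :: s), p; rewrite wE.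
case: e ew cons_embedA => [f|[a|b0]] ew cons_embedA.
- exact: (cons_embedA (inl f)).
- exact: (cons_embedA (inr a)).
(* [b1] is the [B]-edge after the open path: the head of the decoded rest, or [b] if that rest is
   empty. *)
have {cons_embedA} [b1 [t pE]] :
    exists b1 t, rcons (encode codeword p) (inr (inr b)) = inr (inr b1) :: t.
  case: (encode codeword p) hp => [|[|[|b1]] t] //=; first by exists b, [::].
  by exists b1, (rcons t (inr (inr b))).
(* An empty [s] would put two [B]-edges side by side, against alternation. *)
move: ew; rewrite wE rcons_cat pE; case: s wE => [|x s] wE /=.
  by rewrite /alt /alternating /= /bicolour /= andbF.
move=> /andP[ex]; rewrite cat_path /= last_map => /and3P[xs xb _].
have xsP : plug_pred (x, s).
  rewrite /plug_pred /=; apply/and3P; split.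
  - move: xs; rewrite path_map (@eq_path _ _ _ embedA_alt).
    by rewrite path_relI => /andP[cs bs]; rewrite /is_alt_path /is_path /= cs.
  - have : union_src x = tgt b0 by case/andP: ex => /eqP + _; case: (x).
    move=> ->; exact: vertices_plug (tgt_in b0).
  - have : union_tgt (last x s) = src b1.
      by case/andP: xb => /eqP + _; case: (last x s).
    move=> ->; exact: vertices_plug (src_in b1).
by exists [::], (inr b0 :: inl (exist _ (x, s) xsP) :: p).
Qed.

Lemma encode_codeword_surj w : cycle alt w -> has edgeB w ->
  exists p, conjugate (encode codeword p) w.
Proof.
move=> cw hw; have [b [t tw]] : exists b t, conjugate (inr (inr b) :: t) w.
  case/split_find: hw cw => -[//|[//|b]] u v _ _ _; exists b, (v ++ u).
  by exists (size u); rewrite cat_rcons rot_size_cat.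
move: cw; rewrite -(conjugate_cycle _ tw) => ct.
(* Repeating the initial [b] at the end turns the cycle into a path that can be decoded. No open
   piece [s] remains, since the first letter is a [B]-edge. *)
have [|s [p [wE _]]] := @decode_suffix (inr (inr b) :: t) b.
  exact: ct.
case: s wE => [|[?|?] s] //= wE; exists p.
by rewrite -wE.
Qed.

Lemma bracket_union :
  (bracket F (graph_union A B) = bracket F A + bracket (graph_plug F A) B)%E.
Proof.
(* [D] holds the circuits that meet [B]; any representative decides this, since rotation keeps the
   letters. *)
pose D := [set C : set (seq (edge FAB)) | exists2 w, C w & has edgeB w].
pose log w : \bar R := (- lne (1 - w)%:E)%E.
have DE w : D (circuit_of w) <-> has edgeB w.
  split=> [[_ [n _ <-]]|hw]; first by rewrite has_rot.
  by exists w => //; exists 0%N => //; rewrite rot0.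
rewrite {1}/bracket (esumID D); last by move=> C _; exact: circuit_log_ge0.
rewrite addeC; congr (_ + _)%E.
  rewrite /bracket [in RHS]CyclE -(@esum_relabel _ _ _ _ embedA _ alt
    (fun w => ~~ has edgeB w) log).
  - congr (\esum_(C in _) _)%E; rewrite CyclE; apply/seteqP; split=> C.
      by move=> [[w [cw pw] <-] /DE/negP nw]; exists w.
    by move=> [w [cw pw nw] <-]; split; [exists w|apply/DE/negP].
  - exact: embedA_inj.
  - exact: embedA_alt.
  - by case.
  - by move=> p; rewrite has_edgeB_embedA.
  - exact: embedA_surj.
rewrite /bracket [in RHS]CyclE -(@esum_encode _ _ _ _ codeword _ alt edgeB
  (has edgeB) _ _ _ _ _ _ _ _ _ log).
- congr (\esum_(C in _) _)%E; rewrite CyclE; apply/seteqP; split=> C.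
    by move=> [[w [cw pw] <-] /DE nw]; exists w.
  by move=> [w [cw pw nw] <-]; split; [exists w|apply/DE].
- exact: codeword_neq0.
- exact: codeword_special.
- exact: codeword_inj.
- exact: alternating_codeword.
- exact: codeword_sorted.
- exact: codeword_rel.
- exact: codeword_weight.
- exact: encode_has_edgeB.
- by move=> w cw _; exact: encode_codeword_surj.
Qed.

End PlugUnion.

(** * Measurement and duality of projects *)

Section Projects.
Context {R : realType} {U : choiceType}.
Implicit Types a b f : project R U.
Local Open Scope ring_scope.

Lemma measurementC a b : measurement a b = measurement b a.
Proof.
by rewrite /measurement bracketC [((wager a)%:E + _)%E]addeC.
Qed.

Lemma orthogonal_projC a b : orthogonal_proj a b -> orthogonal_proj b a.
Proof. by case=> ab m0 moo; split; rewrite // measurementC. Qed.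

(** The usual Galois argument; the assumption on carriers places [S] inside its bidual, whose
    elements must have carrier [V]. *)
Lemma dual_dual_dual V (S : projects R U) :
  (forall a, S a -> carrier a = V) -> dual V (dual V (dual V S)) = dual V S.
Proof.
move=> SV; apply/funext => b; apply/propext; split=> -[bV ob]; split=> // a Sa.
  apply: ob; split; first exact: SV.
  by move=> c [_ /(_ a Sa)/orthogonal_projC].
by case: Sa => _ /(_ b (conj bV ob))/orthogonal_projC.
Qed.

Definition edgeless (V : {fset U}) : graph R U :=
  @Graph R U V void (fun e => match e with end) (fun e => match e with end)
    (fun e => match e with end) (fun e => match e with end)
    (fun e => match e with end) (fun e => match e with end).

(** All edges have the same colour, so no cycle alternates; a loop fails as well, being compared
    with itself. *)
Lemma bracket_edgeless G V : bracket G (edgeless V) = 0%E.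
Proof.
rewrite /bracket (_ : @Cycl _ _ _ _ = set0)%classic ?esum_set0 // CyclE.
apply/seteqP; split=> // C [p [cp pp] _].
have all_false (e : edge (graph_union G (edgeless V))) : colour e = false.
  by case: e => // -[].
have := primitive_neq0 pp; case: p cp {pp} => // e [|f p] /= /andP[/andP[_]];
  by rewrite /bicolour /= !all_false.
Qed.

Lemma dual_neq0 V (S : projects R U) :
  (forall a, S a -> carrier a = V) -> exists b, dual V S b.
Proof.
(* The bracket vanishes, so the measurement is [wager a + 1], which is finite and positive. *)
move=> SV; exists (Project (edgeless V) ler01); split=> // a /SV aV; split=> //.
all: rewrite /measurement bracket_edgeless adde0 -EFinD //.
by move=> [] /eqP; rewrite gt_eqF // ltr_wpDl // wager_ge0.
Qed.

(** This form does not presuppose that [f :: a] is defined, so it can also serve to prove that it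
    is. *)
Lemma measurement_tensor f a b :
  (carrier a `<=` carrier f)%fset -> (carrier b `<=` carrier f)%fset ->
  [disjoint carrier a & carrier b]%fset ->
  (measurement f (proj_tensor a b) = measurement f a + (wager b)%:E +
    bracket (graph_plug (pgraph f) (pgraph a)) (pgraph b))%E.
Proof.
move=> af bf ab; rewrite /measurement /= bracket_union // EFinD.
by rewrite !addeA -!addeA; congr (_ + (_ + _))%E; rewrite addeCA.
Qed.

Lemma measurement_plug f a b (fa : measurement f a <> +oo%E) :
  (carrier a `<=` carrier f)%fset -> (carrier b `<=` carrier f)%fset ->
  [disjoint carrier a & carrier b]%fset ->
  measurement (proj_plug fa) b = measurement f (proj_tensor a b).
Proof.
move=> af bf ab; rewrite measurement_tensor // {1}/measurement /= fineK //.
by rewrite ge0_fin_numE ?measurement_ge0 // ltey; apply/eqP.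
Qed.

(** The other summands are nonnegative and cannot cancel an infinite one. *)
Lemma measurement_tensor_lty f a b :
  (carrier a `<=` carrier f)%fset -> (carrier b `<=` carrier f)%fset ->
  [disjoint carrier a & carrier b]%fset ->
  measurement f (proj_tensor a b) <> +oo%E -> measurement f a <> +oo%E.
Proof.
move=> af bf ab; rewrite measurement_tensor // => + fa; apply; rewrite fa -addeA.
rewrite addye // gt_eqF // (lt_le_trans ltNy0) //.
by rewrite adde_ge0 ?lee_fin ?wager_ge0 ?bracket_ge0.
Qed.

End Projects.

Theorem mainTheorem3 (R : realType) (U : choiceType) (VA VB : {fset U})
    (A B : projects R U)
    (hA : is_conduct VA A) (hB : is_conduct VB B)
    (disj : [disjoint VA & VB]%fset) :
  lolli A B = dual (VA `|` VB)%fset (tensor VA VB A (dual VB B)).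
Proof.
case: hA hB => [[a0 A0] AV _] [_ BV BE].
have subA : (VA `<=` VA `|` VB)%fset by exact: fsubsetUl.
have subB : (VB `<=` VA `|` VB)%fset by exact: fsubsetUr.
(* The tensor is a bidual, so its dual only has to be tested on pure tensors. *)
rewrite /tensor dual_dual_dual; last first.
  move=> _ [a [b [/AV aV [bV _] ->]]].
  by rewrite /carrier /= -!/(carrier _) aV bV.
apply/funext => f; apply/propext; split=> [ff|[fV fo]].
  have fV : carrier f = (VA `|` VB)%fset.
    (* A single element of [A] fixes the carrier of [f]: its symmetric difference with [VA] is [VB],
       which is disjoint from [VA]. *)
    have [fa0 /BV] := ff a0 A0; rewrite {1}/carrier /= => /fsetP plugV.
    apply/fsetP => v; move: (plugV v).
    rewrite /plug_vertices -!/(carrier _) (AV _ A0) !inE.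
    have [vA|vA] /= := boolP (v \in VA).
      by rewrite (negbTE (fdisjointP disj _ vA)); case: (v \in carrier f).
    by rewrite andbF orbF => ->.
  split=> // _ [a [b [Aa [bV ob] ->]]].
  have [aV [fa Bfa]] := (AV a Aa, ff a Aa); have [_ m0 moo] := ob _ Bfa.
  move: m0 moo; rewrite measurement_plug ?aV ?bV ?fV // => m0 moo.
  apply: orthogonal_projC; split=> //.
  by rewrite /carrier /= -!/(carrier _) fV aV bV.
move=> a Aa; have aV := AV a Aa.
have om b : dual VB B b -> orthogonal_proj f (proj_tensor a b).
  by move=> Bb; apply/orthogonal_projC/fo; exists a, b.
(* Some [b] in the dual of [B] is needed to make [f :: a] defined, through the finite measurement of
   [f] against the tensor of [a] and [b]. *)
have [b Bb] := dual_neq0 BV.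
have fa : measurement f a <> +oo%E.
  have [_ _] := om b Bb; case: Bb => bV _.
  by apply: measurement_tensor_lty; rewrite ?aV ?bV ?fV.
have plugV : carrier (proj_plug fa) = VB.
  apply/fsetP => v; rewrite /carrier /= /plug_vertices -!/(carrier _) aV fV !inE.
  have [vA|vA] /= := boolP (v \in VA).
    by rewrite (negbTE (fdisjointP disj _ vA)).
  by rewrite andbF orbF.
(* As [B] is its own bidual, membership of [f :: a] is tested against the dual of [B]. *)
exists fa; rewrite BE; split=> // b' Bb'.
have [[_ m0 moo] [bV _]] := (om _ Bb', Bb').
by apply: orthogonal_projC; split; rewrite ?measurement_plug ?plugV ?aV ?bV ?fV.
Qed.
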